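(* The event-triggered diffusion Kalman filter for the linear time-varying system $x_{i+1}=F_ix_i+G_in_i$, $y_{kj,i}=H_{j,i}x_i+v_{j,i}$ (the algorithm and all standing assumptions being those given in the context) is an unbiased estimator. That is, for every node $k\in\{1,\dots,N\}$ and every time step $i\ge 0$, $$\mathbb{E}\big[x_i-\hat{x}_{k,i|i-1}\big]=0\qquad\text{and}\qquad \mathbb{E}\big[x_i-\hat{x}_{k,i|i}\big]=0 .$$
   Context: System. There are $N$ nodes, indexed by $k\in\{1,\dots,N\}$; node $k$ has a neighbor set $\mathcal{N}_k\subseteq\{1,\dots,N\}$. The state $x_i\in\mathbb{R}^m$ evolves for $i\ge 0$ by $x_{i+1}=F_ix_i+G_in_i$ with deterministic matrices $F_i,G_i$. At time $i$ the measurement available to node $k$ from its neighbor $j\in\mathcal{N}_k$ is $y_{kj,i}=H_{j,i}x_i+v_{j,i}\in\mathbb{R}^{d}$ with $H_{j,i}$ deterministic. The random vectors $x_0$, $n_i$ ($i\ge0$), $v_{k,i}$ ($1\le k\le N$, $i\ge 0$) are mutually independent; $\mathbb{E}x_0=0$ and $x_0$ has covariance $\Pi_0$ (positive definite); $n_i$ and $v_{k,i}$ are zero-mean Gaussian with $\mathbb{E}[n_in_i^T]=Q_i$ (positive semidefinite) and $\mathbb{E}[v_{k,i}v_{k,i}^T]=R_i$ (positive definite). Diffusion weights. The weights $c_{j,k}\ge 0$ satisfy $c_{j,k}=0$ for $j\notin\mathcal{N}_k$ and $\sum_{j\in\mathcal{N}_k}c_{j,k}=1$ for every $k$ (convex combination).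 Event-triggered diffusion Kalman filter. Fix a leader node $L\in\{1,\dots,N\}$, a (deterministic) weighting matrix $W$ and a threshold $\pi_{\max}\in\mathbb{R}$. Initialize $\hat{x}_{k,0|-1}=0$ and $P_{k,0|-1}=\Pi_0$ for all $k$. At each time $i=0,1,2,\dots$ every node $k$ does the following. (a) If $\operatorname{tr}(WP_{L,i|i-1}W^T)>\pi_{\max}$ (triggering event), perform the measurement update $$P_{k,i|i}^{-1}=P_{k,i|i-1}^{-1}+\sum_{j\in\mathcal{N}_k}H_{j,i}^TR_i^{-1}H_{j,i},$$ $$\Psi_{k,i}=\hat{x}_{k,i|i-1}+P_{k,i|i}\sum_{j\in\mathcal{N}_k}H_{j,i}^TR_i^{-1}\big[y_{kj,i}-H_{j,i}\hat{x}_{k,i|i-1}\big],$$ followed by the diffusion update $\hat{x}_{k,i|i}=\sum_{j\in\mathcal{N}_k}c_{j,k}\Psi_{j,i}$. (b) Otherwise, perform the propagation update $\hat{x}_{k,i|i}=\hat{x}_{k,i|i-1}$, $P_{k,i|i}=P_{k,i|i-1}$. (c) In all cases, perform the time update $\hat{x}_{k,i+1|i}=F_i\hat{x}_{k,i|i}$, $P_{k,i+1|i}=F_iP_{k,i|i}F_i^T+G_iQ_iG_i^T$. The matrices $P_{k,i|i-1}$ are assumed invertible, so that all the steps are well defined. *)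

(* Defs.v *)
(* Built on MathComp and MathComp-Analysis. *)
From HB Require Import structures.
From mathcomp Require Import all_boot all_order all_algebra finmap.
From mathcomp Require Import all_classical all_reals all_analysis.

Set Implicit Arguments.
Unset Strict Implicit.
Unset Printing Implicit Defensive.

Import Order.TTheory GRing.Theory Num.Theory.
Import numFieldNormedType.Exports.

Local Open Scope classical_set_scope.
Local Open Scope ring_scope.

Definition posdefmx (R : realType) n (A : 'M[R]_n) : Prop :=
  A^T = A /\ forall u : 'cV[R]_n, u != 0 -> 0 < (u^T *m A *m u) 0 0.

Definition possemidefmx (R : realType) n (A : 'M[R]_n) : Prop :=
  A^T = A /\ forall u : 'cV[R]_n, 0 <= (u^T *m A *m u) 0 0.

Section RandomVectors.
Context (disp : measure_display) (T : measurableType disp) (R : realType).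
Variable P : probability T R.

(* Column vectors carry no measurable structure in the library; R^n is given
   the product sigma-algebra through n.-tuple R. *)
Definition coords n (X : T -> 'cV[R]_n) (w : T) : n.-tuple R :=
  [tuple X w a 0 | a < n].

Definition random_vector n (X : T -> 'cV[R]_n) : Prop :=
  measurable_fun [set: T] (coords X).

(* The sigma-algebra generated by the random vector X. *)
Definition sigma_rv n (X : T -> 'cV[R]_n) : set_system T :=
  g_sigma_algebra_preimage (coords X).

Definition mutually_independent (I : choiceType) (S : I -> set_system T) :
    Prop :=
  forall (J : {fset I}) (E : I -> set T),
    (forall a, a \in J -> S a (E a)) ->
    P (\bigcap_(a in [set` J]) E a) = (\prod_(a <- J) P (E a))%E.

Definition coord n (X : T -> 'cV[R]_n) (a : 'I_n) : T -> R :=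
  fun w => X w a 0.

(* E[X] = mu, including the existence (integrability) of the expectation. *)
Definition has_mean n (X : T -> 'cV[R]_n) (mu : 'cV[R]_n) : Prop :=
  forall a, coord X a \in Lfun P 1 /\ 'E_P[coord X a]%E = (mu a 0)%:E.

(* E[X X^T] = S, with square-integrable coordinates. *)
Definition has_second_moment n (X : T -> 'cV[R]_n) (S : 'M[R]_n) : Prop :=
  (forall a, coord X a \in Lfun P 2%:E) /\
  (forall a b, expectation P (fun w => (X w *m (X w)^T) a b) = (S a b)%:E).

Definition has_covariance n (X : T -> 'cV[R]_n) (S : 'M[R]_n) : Prop :=
  (forall a, coord X a \in Lfun P 2%:E) /\
  (forall a b, covariance P (coord X a) (coord X b) = (S a b)%:E).

(* Normal law with mean mu and standard deviation s; the case s = 0 has to be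
   treated apart because normal_prob mu 0 is a uniform law, not a point mass. *)
Definition gaussian_law (mu s : R) (A : set R) : \bar R :=
  if s == 0 then \d_mu A else normal_prob mu s A.

(* All linear forms are normal, possibly degenerate: the covariance matrix is
   allowed to be singular. *)
Definition gaussian_vector n (X : T -> 'cV[R]_n) : Prop :=
  random_vector X /\
  forall u : 'cV[R]_n, exists mu s : R, 0 <= s /\
    forall A : set R, measurable A ->
      P ((fun w => (u^T *m X w) 0 0) @^-1` A) = gaussian_law mu s A.

(* The family formed by x0, all the n_i and all the v_{k,i}. *)
Definition source_sigma N m p d (x0 : T -> 'cV[R]_m) (n : nat -> T -> 'cV[R]_p)
    (v : 'I_N -> nat -> T -> 'cV[R]_d) (s : unit + nat + 'I_N * nat) :
    set_system T :=
  match s with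
  | inl (inl _) => sigma_rv x0
  | inl (inr i) => sigma_rv (n i)
  | inr (k, i) => sigma_rv (v k i)
  end.

End RandomVectors.

(* Deterministic data of the system and of the filter.  Dimensions: m for the
   state, p for the process noise, d for the measurements, q for the rows of
   the weighting matrix. *)
Record model (R : realType) (N m p d q : nat) := Model {
  Fm : nat -> 'M[R]_m;
  Gm : nat -> 'M[R]_(m, p);
  Hm : 'I_N -> nat -> 'M[R]_(d, m);
  Qm : nat -> 'M[R]_p;
  Rm : nat -> 'M[R]_d;
  Pi0 : 'M[R]_m;
  nbr : 'I_N -> {set 'I_N};
  weight : 'I_N -> 'I_N -> R;  (* weight j k is c_{j,k} *)
  leader : 'I_N;
  Wm : 'M[R]_(q, m);
  pimax : R
}.

Section Filter.
Context (R : realType) (N m p d q : nat).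
Variable S : model R N m p d q.

Definition triggered (PL : 'M[R]_m) : bool :=
  \tr (Wm S *m PL *m (Wm S)^T) > pimax S.

(* P_{k,i|i} as a function of the family (P_{j,i|i-1})_j *)
Definition cov_update (i : nat) (Pp : 'I_N -> 'M[R]_m) (k : 'I_N) : 'M[R]_m :=
  if triggered (Pp (leader S)) then
    invmx (invmx (Pp k) +
           \sum_(j in nbr S k) (Hm S j i)^T *m invmx (Rm S i) *m Hm S j i)
  else Pp k.

(* cov_prior i k is P_{k,i|i-1} *)
Fixpoint cov_prior (i : nat) : 'I_N -> 'M[R]_m :=
  match i with
  | 0%N => fun=> Pi0 S
  | i'.+1 => fun k =>
      Fm S i' *m cov_update i' (cov_prior i') k *m (Fm S i')^T +
      Gm S i' *m Qm S i' *m (Gm S i')^T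
  end.

(* cov_post i k is P_{k,i|i} *)
Definition cov_post (i : nat) : 'I_N -> 'M[R]_m := cov_update i (cov_prior i).

(* The filter is a function of the data: y k j i is the realized value of the
   measurement y_{kj,i}. *)
Variable y : 'I_N -> 'I_N -> nat -> 'cV[R]_d.

(* Psi_{k,i} as a function of the family of the xhat_{j,i|i-1} *)
Definition local_update (i : nat) (xp : 'I_N -> 'cV[R]_m) (k : 'I_N) :
    'cV[R]_m :=
  xp k + cov_post i k *m
    \sum_(j in nbr S k)
      (Hm S j i)^T *m invmx (Rm S i) *m (y k j i - Hm S j i *m xp k).

(* xhat_{k,i|i} as a function of the family of the xhat_{j,i|i-1} *)
Definition est_update (i : nat) (xp : 'I_N -> 'cV[R]_m) (k : 'I_N) :
    'cV[R]_m :=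
  if triggered (cov_prior i (leader S)) then
    \sum_(j in nbr S k) weight S j k *: local_update i xp j
  else xp k.

(* est_prior i k is xhat_{k,i|i-1} *)
Fixpoint est_prior (i : nat) : 'I_N -> 'cV[R]_m :=
  match i with
  | 0%N => fun=> 0
  | i'.+1 => fun k => Fm S i' *m est_update i' (est_prior i') k
  end.

(* est_post i k is xhat_{k,i|i} *)
Definition est_post (i : nat) : 'I_N -> 'cV[R]_m := est_update i (est_prior i).

End Filter.

(* Main.v *)
(* Each estimation error is obtained from the preceding ones and from the
   noises by a fixed linear map: the trigger depends only on the covariance
   matrices, which are deterministic. Linearity of expectation then propagates
   the zero mean of x_0, n_i and v_{k,i} to all the errors. *)
Require Import Defs.
From HB Require Import structures.
From mathcomp Require Import all_boot all_order all_algebra finmap.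
From mathcomp Require Import all_classical all_reals all_analysis.

Set Implicit Arguments.
Unset Strict Implicit.
Unset Printing Implicit Defensive.

Import Order.TTheory GRing.Theory Num.Theory.
Import numFieldNormedType.Exports.

Local Open Scope classical_set_scope.
Local Open Scope ring_scope.

Section MeanLinearity.
Context (R : realType) (disp : measure_display) (T : measurableType disp).
Variable P : probability T R.

(** Integrability and value go through one induction on [r], since additivity of the expectation
    requires both summands to be integrable. The vector versions below reduce to this one coordinate
    by coordinate. *)
Lemma expectation_lincomb (I : Type) (r : seq I) (Q : pred I) (c : I -> R)
    (f : I -> T -> R) (mu : I -> R) :
  (forall i, f i \in Lfun P 1 /\ 'E_P[f i]%E = (mu i)%:E) ->
  (fun w => \sum_(i <- r | Q i) c i * f i w) \in Lfun P 1 /\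
  expectation P (fun w => \sum_(i <- r | Q i) c i * f i w) =
    (\sum_(i <- r | Q i) c i * mu i)%:E.
Proof.
move=> fmu; have [L0 LD] := Lfun_submod_closed P (lexx (1%:E : \bar R)).
elim: r => [|i r [IHL IHE]].
  have -> : (fun w => \sum_(i <- [::] | Q i) c i * f i w) = cst 0.
    by apply/funext => w; rewrite big_nil.
  by rewrite big_nil expectation_cst.
rewrite [in X in _ /\ _ = X]big_cons.
under eq_fun do rewrite big_cons.
case: (Q i) => //; have [fL fE] := fmu i.
split; first exact: LD.
have cfL : c i \o* f i \in Lfun P 1.
  (* Adding 0 gives the shape [a *: u + v] that [LD] expects, with [L0] covering the second
     summand. *)
  rewrite [X in X \in _](_ : _ = c i *: f i + 0); first exact: LD.
  by apply/funext => w; rewrite addr0 /= mulrC.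
rewrite EFinD -IHE EFinM -fE -(expectationZl (c i) fL) -expectationD//.
by congr expectation; apply/funext => w /=; rewrite [in RHS]mulrC.
Qed.

Lemma has_mean_mulmx k l (A : 'M[R]_(k, l)) (X : T -> 'cV[R]_l) (mu : 'cV[R]_l) :
  has_mean P X mu -> has_mean P (fun w => A *m X w) (A *m mu).
Proof.
move=> Xmu a.
have -> : Defs.coord (fun w => A *m X w) a =
    fun w => \sum_b A a b * Defs.coord X b w.
  by apply/funext => w; rewrite /Defs.coord mxE.
by rewrite mxE; exact: expectation_lincomb.
Qed.

Lemma has_mean_sum (I : Type) (r : seq I) (Q : pred I) l
    (X : I -> T -> 'cV[R]_l) (mu : I -> 'cV[R]_l) :
  (forall i, has_mean P (X i) (mu i)) ->
  has_mean P (fun w => \sum_(i <- r | Q i) X i w) (\sum_(i <- r | Q i) mu i).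
Proof.
move=> Xmu a.
have -> : Defs.coord (fun w => \sum_(i <- r | Q i) X i w) a =
    fun w => \sum_(i <- r | Q i) 1 * Defs.coord (X i) a w.
  apply/funext => w; rewrite /Defs.coord summxE.
  by under [RHS]eq_bigr do rewrite mul1r.
rewrite summxE; under eq_bigr do rewrite -[mu _ a 0]mul1r.
by apply: expectation_lincomb => i; exact: Xmu.
Qed.

Lemma has_meanD l (X Y : T -> 'cV[R]_l) (mu nu : 'cV[R]_l) :
  has_mean P X mu -> has_mean P Y nu ->
  has_mean P (fun w => X w + Y w) (mu + nu).
Proof.
move=> Xmu Ynu.
(* The sum of two vectors is a sum indexed by the booleans. *)
have := @has_mean_sum bool [:: true; false] xpredT l
  (fun b => if b then X else Y) (fun b => if b then mu else nu).
under eq_fun do rewrite !big_cons big_nil addr0.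
by rewrite !big_cons big_nil addr0; apply=> -[].
Qed.

Lemma has_meanZ l (c : R) (X : T -> 'cV[R]_l) (mu : 'cV[R]_l) :
  has_mean P X mu -> has_mean P (fun w => c *: X w) (c *: mu).
Proof.
move=> /(has_mean_mulmx c%:M); rewrite mul_scalar_mx.
by under eq_fun do rewrite mul_scalar_mx.
Qed.

Lemma has_meanB l (X Y : T -> 'cV[R]_l) (mu nu : 'cV[R]_l) :
  has_mean P X mu -> has_mean P Y nu ->
  has_mean P (fun w => X w - Y w) (mu - nu).
Proof.
move=> Xmu /(has_meanZ (-1)) Ynu; rewrite -scaleN1r.
by under eq_fun do rewrite -scaleN1r; exact: has_meanD.
Qed.

(** From here on, the zero-mean cases: linear maps send 0 to 0, so the mean stays syntactically [0]
    and these lemmas chain by plain [apply]. *)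
Lemma mean0_mulmx k l (A : 'M[R]_(k, l)) (X : T -> 'cV[R]_l) :
  has_mean P X 0 -> has_mean P (fun w => A *m X w) 0.
Proof. by move=> /(has_mean_mulmx A); rewrite mulmx0. Qed.

Lemma mean0_sum (I : Type) (r : seq I) (Q : pred I) l (X : I -> T -> 'cV[R]_l) :
  (forall i, has_mean P (X i) 0) ->
  has_mean P (fun w => \sum_(i <- r | Q i) X i w) 0.
Proof. by move=> /(has_mean_sum r Q); rewrite big1_eq. Qed.

Lemma mean0D l (X Y : T -> 'cV[R]_l) :
  has_mean P X 0 -> has_mean P Y 0 -> has_mean P (fun w => X w + Y w) 0.
Proof. by move=> X0 /(has_meanD X0); rewrite addr0. Qed.

Lemma mean0Z l (c : R) (X : T -> 'cV[R]_l) :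
  has_mean P X 0 -> has_mean P (fun w => c *: X w) 0.
Proof. by move=> /(has_meanZ c); rewrite scaler0. Qed.

Lemma mean0B l (X Y : T -> 'cV[R]_l) :
  has_mean P X 0 -> has_mean P Y 0 -> has_mean P (fun w => X w - Y w) 0.
Proof. by move=> X0 /(has_meanB X0); rewrite subr0. Qed.

End MeanLinearity.

Section ErrorRecursion.
Context (R : realType) (N m p d q : nat) (S : model R N m p d q).
Variables (y : 'I_N -> 'I_N -> nat -> 'cV[R]_d) (i : nat).
Variables (x : 'cV[R]_m) (v : 'I_N -> 'cV[R]_d) (xp : 'I_N -> 'cV[R]_m).
Hypothesis meas_eq : forall k j, j \in nbr S k -> y k j i = Hm S j i *m x + v j.

(** For a neighbor [j], the measurement equation turns the innovation into
    [Hm S j i *m (x - xp k) + v j], so the state enters only through the prior error. The identity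
    is algebraic and will be used at each outcome separately. *)
Lemma local_update_error k :
  x - local_update S y i xp k =
  (x - xp k) - cov_post S i k *m
    \sum_(j in nbr S k) (Hm S j i)^T *m invmx (Rm S i) *m
      (Hm S j i *m (x - xp k) + v j).
Proof.
rewrite /local_update opprD addrA; congr (_ - _ *m _).
by apply: eq_bigr => j jk; rewrite meas_eq// [in RHS]mulmxBr [in LHS]addrAC.
Qed.

(* The weights sum to 1, so x is the weighted sum of copies of itself. *)
Lemma est_update_error k : \sum_(j in nbr S k) weight S j k = 1 ->
  x - est_update S y i xp k =
  if triggered S (cov_prior S i (leader S)) then
    \sum_(j in nbr S k) weight S j k *: (x - local_update S y i xp j)
  else x - xp k.
Proof.
rewrite /est_update => w1; case: ifP => // _.
by under [RHS]eq_bigr do rewrite scalerBr; rewrite sumrB -scaler_suml w1 scale1r.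
Qed.

End ErrorRecursion.

Theorem lemma1 (R : realType) (disp : measure_display) (T : measurableType disp)
  (P : probability T R) (N m p d q : nat) (S : model R N m p d q)
  (x : nat -> T -> 'cV[R]_m) (n : nat -> T -> 'cV[R]_p)
  (v : 'I_N -> nat -> T -> 'cV[R]_d) (y : 'I_N -> 'I_N -> nat -> T -> 'cV[R]_d)
  (state_eq : forall i w, x i.+1 w = Fm S i *m x i w + Gm S i *m n i w)
  (meas_eq : forall k j i w, j \in nbr S k ->
     y k j i w = Hm S j i *m x i w + v j i w)
  (x0_rv : random_vector (x 0%N))
  (x0_mean : has_mean P (x 0%N) 0)
  (x0_cov : has_covariance P (x 0%N) (Pi0 S))
  (Pi0_pd : posdefmx (Pi0 S))
  (n_gauss : forall i, gaussian_vector P (n i))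
  (n_mean : forall i, has_mean P (n i) 0)
  (n_cov : forall i, has_second_moment P (n i) (Qm S i))
  (Q_psd : forall i, possemidefmx (Qm S i))
  (v_gauss : forall k i, gaussian_vector P (v k i))
  (v_mean : forall k i, has_mean P (v k i) 0)
  (v_cov : forall k i, has_second_moment P (v k i) (Rm S i))
  (R_pd : forall i, posdefmx (Rm S i))
  (indep : mutually_independent P (source_sigma (x 0%N) n v))
  (weight_ge0 : forall j k, 0 <= weight S j k)
  (weight_nbr : forall j k, j \notin nbr S k -> weight S j k = 0)
  (weight_sum : forall k, \sum_(j in nbr S k) weight S j k = 1)
  (cov_inv : forall i k, cov_prior S i k \in unitmx) :
  forall (k : 'I_N) (i : nat),
    has_mean P (fun w => x i w - est_prior S (fun a b t => y a b t w) i k) 0 /\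
    has_mean P (fun w => x i w - est_post S (fun a b t => y a b t w) i k) 0.
Proof.
pose yw w a b t := y a b t w.
(* The prior errors of all nodes are needed at once, because diffusion mixes the estimates of the
   neighbors. *)
have post i : (forall k, has_mean P (fun w => x i w - est_prior S (yw w) i k) 0) ->
    forall k, has_mean P (fun w => x i w - est_post S (yw w) i k) 0.
  move=> prior k.
  have meas w a b : b \in nbr S a -> yw w a b i = Hm S b i *m x i w + v b i w.
    exact: meas_eq.
  rewrite (funext (fun w => est_update_error (yw w) i (x i w)
    (est_prior S (yw w) i) (weight_sum k))).
  (* The test does not involve [w], so a single case split serves all outcomes; without a trigger
     the goal is [prior k]. *)
  case: (triggered _ _) => //; apply: mean0_sum => j; apply: mean0Z.
  rewrite (funext (fun w => local_update_error (est_prior S (yw w) i) (meas w) j)).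
  apply: mean0B => //; apply: mean0_mulmx; apply: mean0_sum => l.
  by apply: mean0_mulmx; apply: mean0D => //; exact: mean0_mulmx.
suff prior i : forall k, has_mean P (fun w => x i w - est_prior S (yw w) i k) 0.
  by move=> k i; split; [exact: prior | exact: post].
(* At time 0 the estimate is 0, so the error is [x 0] itself and [x0_mean] applies. *)
elim: i => [|i IH] k; first by under eq_fun do rewrite subr0.
(* State and estimate are propagated by the same [Fm S i], so the new prior error is the image of
   the posterior one plus process noise. *)
have -> : (fun w => x i.+1 w - est_prior S (yw w) i.+1 k) =
    fun w => Fm S i *m (x i w - est_post S (yw w) i k) + Gm S i *m n i w.
  by apply/funext => w; rewrite state_eq /= mulmxBr addrAC.
by apply: mean0D; apply: mean0_mulmx => //; exact: post.
Qed.
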